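(* Let $w_1,w_2,w_3,\dots$ be a sequence of non-negative real numbers and, for each $n\in\mathbb{N}$, let $[q^{(n)};(w_1,\dots,w_n)]$ be a representation of an $n$-player weighted majority game. Put $\bar q^{(n)}=q^{(n)}/\sum_{l=1}^n w_l$ and $\bar w_k^{(n)}=w_k/\sum_{l=1}^n w_l$ for $1\le k\le n$. Suppose that neither $0$ nor $1$ is a cluster point of the sequence $\{\bar q^{(n)}\}_{n\in\mathbb{N}}$, and that the normalized weights satisfy $\bar w_k^{(n)}\downarrow 0$ as $n\to\infty$ for every $k\in\mathbb{N}$. Then the nucleolus $x^{*(n)}$ of the weighted majority game represented by $[q^{(n)};(w_1,\dots,w_n)]$ satisfies $$\lim_{n\to\infty}\frac{x_i^{*(n)}}{x_j^{*(n)}}=\frac{w_i}{w_j}$$ for any regular players $i$ and $j$.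
   Context: The weighted majority game represented by $[q;w_1,\dots,w_n]$ (quota $q$, weights $w_i\ge 0$) is the function $v$ on subsets $S$ of $N=\{1,\dots,n\}$ given by $v(S)=1$ if $\sum_{i\in S}w_i\ge q$ and $v(S)=0$ otherwise. It is understood that $v(\varnothing)=0$ and $v(N)=1$, i.e. $0<q\le\sum_{i=1}^n w_i$. For $x\in\mathbb{R}^n$ write $x(S)=\sum_{i\in S}x_i$. An imputation is a vector $x\in\mathbb{R}^n$ with $x_i\ge v(\{i\})$ for all $i\in N$ and $x(N)=v(N)$. The excess of $S\subseteq N$ at an imputation $x$ is $e(S,x)=v(S)-x(S)$. Let $E(x)\in\mathbb{R}^{2^n}$ be the vector of the excesses of all $2^n$ coalitions $S\subseteq N$ at $x$, arranged in weakly decreasing order. An imputation $x$ is lexicographically less than an imputation $y$ if $E_k(x)<E_k(y)$ for the smallest index $k$ with $E_k(x)\ne E_k(y)$. The nucleolus of $(N,v)$ is the unique lexicographically minimal imputation (it is not defined if more than one singleton coalition $\{i\}$ has $v(\{i\})=1$, since then there are no imputations). For $\omega\ge 0$ let $m_\omega(n)$ be the number of players $i\in\{1,\dots,n\}$ with $w_i=\omega$. A player $j\in\mathbb{N}$ is called regular (for the given weight sequence) if $m_{w_j}(n)\cdot \bar w_j^{(n)}$ is bounded away from $0$ by some constant, i.e. there is a constant $\varepsilon>0$ such that $m_{w_j}(n)\cdot \bar w_j^{(n)}\ge\varepsilon$ for all $n\ge j$.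
   Formalization: The condition that each fixed player's normalized weight decreases to 0 is strengthened to: the largest normalized weight among the n players tends to 0. With the fixed-player condition alone the claim is false, since late heavy players can repeatedly hold a fixed share of the total weight. *)

(* Defs.v *)
From HB Require Import structures.
From mathcomp Require Import all_boot all_order all_algebra.
From mathcomp Require Import all_classical all_reals all_analysis.

Set Implicit Arguments.
Unset Strict Implicit.
Unset Printing Implicit Defensive.

Import Order.TTheory GRing.Theory Num.Theory.
Import numFieldNormedType.Exports.

Local Open Scope ring_scope.

(* Players are numbered from 0: the players of the n-player game are the
   k : nat with k < n, i.e. the elements of 'I_n. *)

Section CooperativeGame.
Variables (R : realType) (n : nat).
Implicit Types (v : {set 'I_n} -> R) (x y : 'rV[R]_n) (A : {set 'I_n}).

Definition coalition_payoff x A : R := \sum_(i in A) x ord0 i.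

Definition imputation v x : Prop :=
  (forall i : 'I_n, v [set i]%SET <= x ord0 i) /\
  coalition_payoff x [set: 'I_n]%SET = v [set: 'I_n]%SET.

Definition excess v x A : R := v A - coalition_payoff x A.

(* The 2 ^ n excesses, with multiplicity, in weakly decreasing order. *)
Definition excess_vector v x : seq R :=
  sort >=%R [seq excess v x A | A : {set 'I_n}].

Definition lex_less v x y : Prop :=
  exists k : nat, [/\ (k < 2 ^ n)%N,
    (forall l : nat, (l < k)%N -> (excess_vector v x)`_l = (excess_vector v y)`_l)
    & (excess_vector v x)`_k < (excess_vector v y)`_k].

(* A lexicographically minimal imputation. It exists as soon as there is an
   imputation, and is then unique (Schmeidler); neither fact is built in. *)
Definition is_nucleolus v x : Prop :=
  imputation v x /\ forall y, imputation v y -> ~ lex_less v y x.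

Definition weighted_majority_game (q : R) (w : 'I_n -> R) A : R :=
  if q <= \sum_(i in A) w i then 1 else 0.

(* Coordinate of player i : nat, with the dummy value 0 when i is not one of
   the n players. *)
Definition payoff x (i : nat) : R := oapp (x ord0) 0 (insub i : option 'I_n).

End CooperativeGame.

Section WeightSequence.
Variable R : realType.
Implicit Types (w q : nat -> R).

Definition total_weight w (n : nat) : R := \sum_(l < n) w l.

Definition normalized_quota q w (n : nat) : R := q n / total_weight w n.

Definition normalized_weight w (k n : nat) : R := w k / total_weight w n.

(* The normalized weights of the players of the n-player game decrease to 0 as
   n tends to infinity, for all players at once: max_(k < n) of the normalized
   weights tends to 0. Convergence for each fixed k would not do: it allows
   the most recent players to keep a fixed share of the total weight. For
   instance, let weights 1, 2, 1, 2, ... of total W be followed by three players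
   of weight 3 W, with quota 4 W at that point. The minimal winning coalitions
   consist of two large players, or of one large player and all the other
   ones, so that the nucleolus treats the players of weights 1 and 2 alike;
   repeating this pattern at sparse enough times, the former convergence holds
   and the weights 1 and 2 are regular. *)
Definition weights_decrease_to0 w : Prop :=
  (forall k n : nat, (k < n)%N ->
     normalized_weight w k n.+1 <= normalized_weight w k n) /\
  (forall eps : R, 0 < eps ->
     exists n0 : nat, forall n, (n0 <= n)%N ->
       forall k : nat, (k < n)%N -> normalized_weight w k n < eps).

Definition multiplicity w (omega : R) (n : nat) : nat :=
  #|[set i : 'I_n | w i == omega]%SET|.

Definition regular_player w (j : nat) : Prop :=
  exists2 eps : R, 0 < eps & forall n : nat, (j < n)%N ->
    eps <= (multiplicity w (w j) n)%:R * normalized_weight w j n.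

Definition sequence_game q w (n : nat) : {set 'I_n} -> R :=
  weighted_majority_game (q n) (fun i : 'I_n => w i).

End WeightSequence.

Arguments sequence_game {R} q w n _.

(* Main.v *)
Require Import Defs.
From HB Require Import structures.
From mathcomp Require Import all_boot all_order all_algebra.
From mathcomp Require Import fingroup perm.
From mathcomp Require Import all_classical all_reals all_analysis.
From mathcomp Require Import ring lra.

(** Write W for the total weight. At the imputation whose payoffs are the
    normalized weights, a winning coalition has excess at most 1 - q / W and a
    losing one at most 0, so the maximal excess is at most 1 - q / W. The
    nucleolus x minimizes the maximal excess, hence x(S) >= q / W for every
    winning S ([nucleolus_winning_payoff]).

    Fill up a coalition S with players in increasing order of payoff per unit
    of weight until it wins. It overshoots the quota by at most the largest
    normalized weight D, so its payoff, which is at least q / W, falls short of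
    its weight by at most D. The payoff rate of the last player to join bounds
    the rates inside S from above and those outside S from below, so this one
    nearly tight inequality controls the deviation between payoffs and weights
    of all coalitions at once: |x(A) - w(A) / W| is at most D / c when q / W and
    1 - q / W - D are at least c ([payoffs_near_weights]). Under the hypotheses
    c can be fixed while D tends to 0.

    To go from coalitions to individuals, take for A the class of the m players
    having the weight of a regular player j. The nucleolus pays them equally
    ([nucleolus_equal_weights]), so that m |x_j - w_j / W| tends to 0 while
    m w_j / W stays away from 0; thus x_j / (w_j / W) tends to 1
    ([regular_payoff_asymptotics]), and dividing the limits for two regular
    players gives the theorem.

    The equal payments rest on the uniqueness argument for the nucleolus. If
    permuting two interchangeable players changed x, the midpoint of x and the
    permuted vector would be lexicographically less than x
    ([midpoint_lex_less]). *)

Set Implicit Arguments.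
Unset Strict Implicit.
Unset Printing Implicit Defensive.

Import Order.TTheory GRing.Theory Num.Theory.
Import numFieldNormedType.Exports.

Local Open Scope classical_set_scope.
Local Open Scope ring_scope.

(** * Payoffs that respect the quota are close to the weights *)

Section Threshold.
Variables (R : realFieldType) (T : finType).
Implicit Types (w x f : T -> R) (S A : {set T}).

(** The coalition that first reaches the quota when players join in increasing
    order of [x i / w i]; [rho] is the ratio of the last one. Both ratio bounds
    are cleared of denominators so that they also make sense for players of
    weight 0, who never join. *)
Lemma threshold_coalition w x (q D : R) :
  (forall i, 0 <= w i <= D) -> (forall i, 0 <= x i) ->
  0 < q <= \sum_i w i ->
  exists S (rho : R),
    [/\ q <= \sum_(i in S) w i, \sum_(i in S) w i <= q + D,
        forall i, i \in S -> x i <= rho * w i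
      & forall i, i \notin S -> rho * w i <= x i].
Proof.
move=> w0D x0 /andP[q0 qw].
pose r i := x i / w i.
pose pos := [set i | 0 < w i]%SET.
(* [P]: losing initial segments of the players of positive weight, ordered by
   ratio. *)
pose initial S := (S \subset pos) &&
  [forall i in S, forall j in pos :\: S, r i <= r j].
pose P S := initial S && (\sum_(i in S) w i < q).
have P0 : P finset.set0.
  rewrite /P /initial finset.sub0set big_set0 q0 /= andbT.
  by apply/forall_inP => i; rewrite finset.in_set0.
have [S /andP[/andP[Spos Slow] Sq] Smax] := @arg_maxnP _ finset.set0 P (fun S => #|S|) P0.
have wpos : \sum_(i in pos) w i = \sum_i w i.
  rewrite [RHS](bigID (mem pos)) /= [X in _ = _ + X]big1 ?addr0 // => i.
  rewrite inE -leNgt => wi; apply/eqP; rewrite eq_le wi.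
  by case/andP: (w0D i).
(* A maximal losing segment [S] leaves out some player of positive weight; the
   one of least ratio is the pivot. *)
have [k kD] : exists k, k \in pos :\: S.
  apply/set0Pn; apply: contraTneq (lt_le_trans Sq qw) => D0.
  suff -> : S = pos by rewrite wpos ltxx.
  by apply/eqP; rewrite finset.eqEsubset Spos /= -finset.setD_eq0 D0.
have [i0 i0D i0min] := @arg_minP _ _ _ k (fun i => i \in pos :\: S) r kD.
have := i0D; rewrite !inE => /andP[i0S w0].
have rS i : i \in S -> r i <= r i0.
  by move=> iS; move/forall_inP/(_ i iS)/forall_inP: Slow; apply.
have wD : \sum_(i in i0 |: S) w i = w i0 + \sum_(i in S) w i by rewrite big_setU1.
exists (i0 |: S)%SET, (r i0); split.
- rewrite leNgt; apply/negP => lt.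
  have : P (i0 |: S)%SET.
    rewrite /P lt andbT; apply/andP; split.
      by rewrite finset.subUset Spos finset.sub1set inE w0.
    apply/forall_inP => i; rewrite !inE => iS; apply/forall_inP => j jD.
    have jD' : j \in pos :\: S.
      by move: jD; rewrite !inE negb_or => /andP[/andP[_ ->] ->].
    apply: le_trans (i0min _ jD').
    by case/orP: iS => [/eqP ->//|/rS].
  by move=> /Smax /=; rewrite cardsU1 i0S add1n ltnn.
- rewrite wD addrC lerD //; first exact: ltW.
  by case/andP: (w0D i0).
- move=> i /finset.setU1P iS.
  have wi : 0 < w i.
    by case: iS => [->//|/(fintype.subsetP Spos)]; rewrite inE.
  by rewrite -ler_pdivrMr //; case: iS => [->//|/rS].
- move=> i; rewrite inE negb_or => /andP[_ iS].
  have [wi|wi] := ltP 0 (w i).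
    rewrite -ler_pdivlMr //; apply: i0min; by rewrite !inE iS.
  have -> : w i = 0 by apply/eqP; rewrite eq_le wi; case/andP: (w0D i).
  by rewrite mulr0.
Qed.

Lemma sum_setC f A : \sum_(i in ~: A) f i = \sum_i f i - \sum_(i in A) f i.
Proof.
rewrite [X in X - _](bigID (mem A)) /= addrAC subrr add0r.
by apply: eq_bigl => i; rewrite inE.
Qed.

(** Where [f] is nonnegative, summing over all of [S] only increases the sum;
    elsewhere the nonnegative majorant [g] allows the same. *)
Lemma sum_le_split f g S A :
  (forall i, i \in S -> 0 <= f i) -> (forall i, i \notin S -> f i <= g i) ->
  (forall i, i \notin S -> 0 <= g i) ->
  \sum_(i in A) f i <= \sum_(i in S) f i + \sum_(i in ~: S) g i.
Proof.
move=> fS fg g0.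
rewrite [in leLHS](bigID (mem S)) /=; apply: lerD.
  rewrite [in leRHS](bigID (mem A)) /= (eq_bigl (fun i => (i \in S) && (i \in A))).
    by rewrite lerDl sumr_ge0 // => i /andP[/fS].
  by move=> i; rewrite andbC.
apply: (@le_trans _ _ (\sum_(i in A | i \notin S) g i)).
  by apply: ler_sum => i /andP[_ /fg].
rewrite [in leRHS](bigID (mem A)) /= (eq_bigl (fun i => (i \in ~: S)%SET && (i \in A))).
  by rewrite lerDl sumr_ge0 // => i /andP[]; rewrite inE => /g0.
by move=> i; rewrite inE andbC.
Qed.

(** For the threshold coalition [S] the quota condition is tight up to [D]. If
    [rho <= 1], every member of [S] gets at most its weight, with total
    shortfall at most [D], so that [(1 - rho) * w(S) <= D]; a player outside
    [S] falls short of its weight by at most the fraction [1 - rho]. The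
    shortfall of any coalition, multiplied by [w(S)], is then at most
    [D * w(S) + D * (1 - w(S)) = D]. If [rho > 1], exchange the roles of [S]
    and its complement, and of shortfall and surplus. *)
Lemma payoffs_near_weights w x (q c D : R) :
  (forall i, 0 <= w i <= D) -> (forall i, 0 <= x i) ->
  \sum_i w i = 1 -> \sum_i x i = 1 -> 0 < c -> c <= q -> q + D <= 1 - c ->
  (forall S, q <= \sum_(i in S) w i -> q <= \sum_(i in S) x i) ->
  forall A, c * `|\sum_(i in A) x i - \sum_(i in A) w i| <= D.
Proof.
move=> w0D x0 w1 x1 c0 cq qD win.
have D0 : 0 <= D.
  rewrite leNgt; apply/negP => Dlt.
  suff : (1 : R) <= 0 by rewrite ler10.
  rewrite -w1; apply: sumr_le0 => i _.
  by case/andP: (w0D i) => _ /le_trans -> //; exact: ltW.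
have w0 i : 0 <= w i by case/andP: (w0D i).
have [|S [rho [qS Sq Srho Crho]]] := @threshold_coalition w x q D w0D x0.
  by rewrite (lt_le_trans c0 cq) w1; lra.
have xS := win _ qS.
have wC := sum_setC w S; have xC := sum_setC x S.
rewrite w1 in wC; rewrite x1 in xC.
set WS := \sum_(i in S) w i in qS Sq wC *.
set XS := \sum_(i in S) x i in xS xC *.
pose d A : R := \sum_(i in A) x i - \sum_(i in A) w i.
have dC A : d (~: A)%SET = - d A.
  by rewrite /d !sum_setC x1 w1; ring.
(* A bound for the surplus of every coalition is one for the shortfall of every
   coalition, by complementation; so one sign is enough. *)
suff [s s1 H] : exists2 s : R, s = 1 \/ s = -1 & forall A, c * (s * d A) <= D.
  move=> A; have h1 := H A; have := H (~: A)%SET; rewrite dC => h2.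
  rewrite -/(d A) -[X in X * _]gtr0_norm // -normrM ler_norml.
  by case: s1 => se; rewrite se in h1 h2; apply/andP; split; lra.
have XSrho : XS <= rho * WS.
  by rewrite /XS /WS mulr_sumr; apply: ler_sum.
have XCrho : rho * (1 - WS) <= 1 - XS.
  rewrite -wC -xC mulr_sumr; apply: ler_sum => i; rewrite inE; exact: Crho.
have [rho1|rho1] := leP rho 1.
- exists (-1); first by right.
  move=> A.
  have : - d A <= (WS - XS) + (1 - rho) * (1 - WS).
    rewrite /d opprB -wC mulr_sumr -!sumrB.
    apply: sum_le_split => i /= iS.
    - have := Srho i iS; have := w0 i; nra.
    - have := Crho i iS; have := w0 i; nra.
    - have := w0 i; nra.
  rewrite mulN1r => hd.
  have h : (1 - rho) * WS <= D by nra.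
  have hc : c <= WS by lra.
  have h1 : c * - d A <= c * ((WS - XS) + (1 - rho) * (1 - WS)) by rewrite ler_pM2l.
  apply: le_trans h1 _.
  have p1 : 0 <= WS - XS + (1 - rho) * (1 - WS) by nra.
  have : c * (WS - XS + (1 - rho) * (1 - WS)) <= WS * (WS - XS + (1 - rho) * (1 - WS)).
    by apply: ler_wpM2r.
  have e1 : WS * (WS - XS) <= WS * D by apply: ler_wpM2l; lra.
  have e2 : (1 - rho) * WS * (1 - WS) <= D * (1 - WS) by apply: ler_wpM2r; lra.
  nra.
- exists 1; first by left.
  move=> A.
  have : d A <= (WS - XS) + (rho - 1) * WS.
    have -> : WS - XS = \sum_(i in ~: S) (x i - w i) by rewrite sumrB wC xC; ring.
    rewrite /d /WS mulr_sumr -!sumrB.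
    rewrite -[in X in _ + X](finset.setCK S).
    apply: sum_le_split => i /=; rewrite inE ?negbK => iS.
    - have := Crho i iS; have := w0 i; nra.
    - have := Srho i iS; have := w0 i; nra.
    - have := w0 i; nra.
  rewrite mul1r => hd.
  have h : (rho - 1) * (1 - WS) <= D by nra.
  have hc : c <= 1 - WS by lra.
  have h1 : c * d A <= c * ((WS - XS) + (rho - 1) * WS) by rewrite ler_pM2l.
  apply: le_trans h1 _.
  have p1 : 0 <= WS - XS + (rho - 1) * WS by nra.
  have : c * (WS - XS + (rho - 1) * WS) <= (1 - WS) * (WS - XS + (rho - 1) * WS).
    by apply: ler_wpM2r.
  have e1 : (1 - WS) * (WS - XS) <= (1 - WS) * D by apply: ler_wpM2l; lra.
  have e2 : (rho - 1) * (1 - WS) * WS <= D * WS by apply: ler_wpM2r; lra.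
  nra.
Qed.

End Threshold.

(** * Lexicographic comparison of decreasing sequences *)

Section Sorted.
Variable R : realFieldType.
Implicit Types s t : seq R.

Lemma sorted_ge_nth s (a b : nat) : sorted >=%R s ->
  (a <= b)%N -> (b < size s)%N -> s`_b <= s`_a.
Proof.
move=> ss ab bs; apply: (sorted_leq_nth (leT := >=%R)) => //.
- by move=> y x z /= yx zy; apply: le_trans zy yx.
- by move=> y /=; rewrite lexx.
- by rewrite inE (leq_ltn_trans ab).
Qed.

(** The hinge function at level [t`_k] does not see the entries of [t] from rank
    [k] on, so the sums over [s] and [t] agree below rank [k] and only [s] has a
    positive contribution afterwards. This turns the lexicographic order into
    inequalities between sums of convex functions. *)
Lemma hinge_sum_lt s t (k : nat) : sorted >=%R t -> size s = size t ->
  (k < size t)%N -> (forall l, (l < k)%N -> s`_l = t`_l) -> t`_k < s`_k ->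
  \sum_(a <- t) Num.max (a - t`_k) 0 < \sum_(a <- s) Num.max (a - t`_k) 0.
Proof.
move=> st sz kt eqk ltk.
rewrite [ltLHS](big_nth 0) [ltRHS](big_nth 0) sz.
rewrite [ltLHS](big_cat_nat (leq0n k) (ltnW kt)) [ltRHS](big_cat_nat (leq0n k) (ltnW kt)) /=.
have -> : \sum_(0 <= l < k) Num.max (s`_l - t`_k) 0 =
          \sum_(0 <= l < k) Num.max (t`_l - t`_k) 0.
  by apply: eq_big_nat => l /andP[_ /eqk ->].
rewrite ltrD2l big1_seq.
  rewrite big_ltn //; apply: ltr_wpDr.
    by apply: sumr_ge0 => l _; rewrite le_max lexx orbT.
  by rewrite lt_max subr_gt0 ltk.
move=> l; rewrite mem_index_iota => /andP[_ /andP[kl ls]].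
by apply/max_idPr; rewrite subr_le0 sorted_ge_nth.
Qed.

Lemma seq_first_difference s t : size s = size t -> s <> t ->
  exists k, [/\ (k < size t)%N, forall l, (l < k)%N -> s`_l = t`_l
              & s`_k != t`_k].
Proof.
move=> sz neq.
pose P k := (k < size t)%N && (s`_k != t`_k).
have exP : exists k, P k.
  apply: contrapT => nP; apply: neq; apply: (@eq_from_nth _ 0) => // l.
  rewrite sz => lt; apply: contrapT => /eqP ne; apply: nP.
  by exists l; rewrite /P lt ne.
case: (ex_minnP exP) => k /andP[kt ne] kmin; exists k; split=> // l lk.
apply: contrapT => /eqP nel.
have /kmin : P l by rewrite /P (ltn_trans lk kt) nel.
by rewrite leqNgt lk.
Qed.

End Sorted.

Section Midpoint.
Variables (R : realFieldType) (T : finType).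
Implicit Types f g : T -> R.

Definition decreasing_values f : seq R := sort >=%R [seq f a | a : T].

Lemma size_decreasing_values f : size (decreasing_values f) = #|T|.
Proof. by rewrite size_sort size_map -cardE. Qed.

Lemma decreasing_values_sorted f : sorted >=%R (decreasing_values f).
Proof. by apply: sort_sorted => a b; apply: le_total. Qed.

Lemma sum_decreasing_values f (phi : R -> R) :
  \sum_(a <- decreasing_values f) phi a = \sum_a phi (f a).
Proof.
rewrite /decreasing_values (perm_big [seq f a | a : T]) ?perm_sort //=.
by rewrite big_map big_enum.
Qed.

Lemma mem_decreasing_values f a : f a \in decreasing_values f.
Proof. by rewrite mem_sort map_f // mem_enum. Qed.

Lemma le_head_decreasing_values f a : f a <= (decreasing_values f)`_0.
Proof.
have /(nthP 0) [k ks <-] := mem_decreasing_values f a.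
exact: sorted_ge_nth (decreasing_values_sorted f) (leq0n k) ks.
Qed.

Lemma head_decreasing_values f (a0 : T) :
  exists a, (decreasing_values f)`_0 = f a.
Proof.
have : (decreasing_values f)`_0 \in decreasing_values f.
  by rewrite mem_nth // size_decreasing_values; apply/card_gt0P; exists a0.
by rewrite mem_sort => /mapP[a _ ->]; exists a.
Qed.

(** The midpoint [h] of two rearrangements has smaller sums of convex functions.
    For hinge functions this excludes that sorted [h] is lexicographically
    above sorted [f]; for squares, where strict convexity applies, it excludes
    that they are equal. *)
Lemma midpoint_lex_less f g :
  (forall phi : R -> R, \sum_a phi (f a) = \sum_a phi (g a)) ->
  let h a := (f a + g a) / 2 in
  (exists a, f a != g a) ->
  exists k : nat, [/\ (k < #|T|)%N,
    (forall l : nat, (l < k)%N ->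
       (decreasing_values h)`_l = (decreasing_values f)`_l)
    & (decreasing_values h)`_k < (decreasing_values f)`_k].
Proof.
move=> fg h [a0 ne].
have neq : decreasing_values h <> decreasing_values f.
  move=> eq.
  have hf : \sum_a h a ^+ 2 = \sum_a f a ^+ 2.
    by rewrite -!(sum_decreasing_values _ (fun u => u ^+ 2)) eq.
  have : \sum_a (f a - g a) ^+ 2 = 0.
    transitivity (\sum_a (2 * f a ^+ 2 + 2 * g a ^+ 2 - 4 * h a ^+ 2)).
      by apply: eq_bigr => a _; rewrite /h; field.
    rewrite sumrB big_split /= -!mulr_sumr -(fg (fun u => u ^+ 2)) hf; ring.
  move/eqP; rewrite psumr_eq0; last by move=> a _; exact: sqr_ge0.
  move=> /allP /(_ a0); rewrite mem_index_enum => /(_ isT).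
  by rewrite expf_eq0 /= subr_eq0 (negbTE ne).
have sz : size (decreasing_values h) = size (decreasing_values f).
  by rewrite !size_decreasing_values.
have [k [kt eqk]] := seq_first_difference sz neq.
rewrite neq_lt => /orP[lt|lt].
  by exists k; split=> //; rewrite size_decreasing_values in kt.
have := hinge_sum_lt (decreasing_values_sorted f) sz kt eqk lt.
set c := (decreasing_values f)`_k.
rewrite !(sum_decreasing_values _ (fun u => Num.max (u - c) 0)) ltNge => /negP[].
have -> : \sum_a Num.max (f a - c) 0 =
    \sum_a (Num.max (f a - c) 0 + Num.max (g a - c) 0) / 2.
  rewrite -mulr_suml big_split /= -(fg (fun u => Num.max (u - c) 0)).
  by field.
apply: ler_sum => a _; rewrite /h ge_max; apply/andP.
have f1 : f a - c <= Num.max (f a - c) 0 by rewrite le_max lexx.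
have f2 : 0 <= Num.max (f a - c) 0 by rewrite le_max lexx orbT.
have g1 : g a - c <= Num.max (g a - c) 0 by rewrite le_max lexx.
have g2 : 0 <= Num.max (g a - c) 0 by rewrite le_max lexx orbT.
split; lra.
Qed.

End Midpoint.

(** * Extremal and symmetry properties of the nucleolus *)

Section Nucleolus.
Variables (R : realType) (n : nat).
Implicit Types (v : {set 'I_n} -> R) (x y : 'rV[R]_n) (A : {set 'I_n}).

Lemma excess_vectorE v x :
  excess_vector v x = decreasing_values (excess v x).
Proof. by []. Qed.

(** The maximal excess is the first entry compared in the lexicographic order. *)
Lemma nucleolus_max_excess v x y (b : R) : is_nucleolus v x -> imputation v y ->
  (forall A, excess v y A <= b) -> forall A, excess v x A <= b.
Proof.
move=> [_ xmin] yimp yb A.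
apply: le_trans (le_head_decreasing_values (excess v x) A) _.
have [B yB] := head_decreasing_values (excess v y) finset.set0.
apply: le_trans (yb B); rewrite -yB leNgt; apply/negP => lt.
apply: (xmin y yimp); exists 0%N; split=> //; by rewrite expn_gt0.
Qed.

(** Symmetries of the game permute the excesses, so if [x] were not invariant,
    its midpoint with the permuted payoff vector would beat it. *)
Lemma nucleolus_symmetric v x (s : {perm 'I_n}) : is_nucleolus v x ->
  (forall A, v (s @: A)%SET = v A) -> forall i, x ord0 (s i) = x ord0 i.
Proof.
move=> [[xi xN] xmin] vs i; apply: contrapT => /eqP ne.
pose z : 'rV[R]_n := \row_k ((x ord0 k + x ord0 (s k)) / 2).
have payz A : coalition_payoff z A =
    (coalition_payoff x A + coalition_payoff x (s @: A)%SET) / 2.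
  rewrite /coalition_payoff big_imset /=; last by move=> ? ? _ _; exact: perm_inj.
  rewrite -big_split /= mulr_suml; by apply: eq_bigr => k _; rewrite mxE.
have zimp : imputation v z.
  split=> [k|].
    have := xi k; have := xi (s k).
    rewrite -imset_set1 vs mxE; lra.
  rewrite payz.
  have -> : (s @: [set: 'I_n] = [set: 'I_n])%SET.
    apply/setP => k; rewrite finset.in_setT; apply/imsetP.
    by exists (s^-1 k)%g; rewrite ?finset.in_setT ?permKV.
  by rewrite xN; field.
apply: (xmin z zimp); rewrite /lex_less !excess_vectorE.
have -> : excess v z = fun A => (excess v x A + excess v x (s @: A)%SET) / 2.
  by apply/funext => A; rewrite /excess payz vs; field.
have -> : (2 ^ n = #|{: {set 'I_n}}|)%N.
  by rewrite -cardsT -powersetT card_powerset cardsT card_ord.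
apply: (@midpoint_lex_less _ _ (excess v x) (fun A => excess v x (s @: A)%SET)).
  move=> phi; rewrite (reindex_inj (h := fun A => (s @: A)%SET)) //.
  exact: imset_inj (@perm_inj _ s).
exists [set i]%SET; apply: contra_neq ne.
rewrite /excess vs imset_set1 /coalition_payoff !big_set1 => /addrI /oppr_inj ->//.
Qed.

End Nucleolus.

(** * The nucleolus of a weighted majority game *)

Section WeightedMajority.
Variables (R : realType) (n : nat) (q D : R) (w : 'I_n -> R).
Local Notation W := (\sum_k w k).
Local Notation v := (weighted_majority_game q w).
Implicit Types (x : 'rV[R]_n) (A : {set 'I_n}).

Definition normalized_weights : 'rV[R]_n := \row_k (w k / W).

Lemma coalition_payoff_weights A :
  coalition_payoff normalized_weights A = (\sum_(k in A) w k) / W.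
Proof.
by rewrite /coalition_payoff mulr_suml; apply: eq_bigr => k _; rewrite mxE.
Qed.

Lemma game_setT : q <= W -> v [set: 'I_n]%SET = 1.
Proof.
move=> qW; rewrite /weighted_majority_game.
by rewrite (eq_bigl xpredT) ?qW // => k; rewrite finset.in_setT.
Qed.

Lemma game_ge0 A : 0 <= v A.
Proof. by rewrite /weighted_majority_game; case: ifP. Qed.

(** Players lighter than the quota lose on their own, so that individual
    rationality only asks for nonnegative payoffs. *)
Lemma weights_imputation : (forall k, 0 <= w k < q) -> 0 < q <= W ->
  imputation v normalized_weights.
Proof.
move=> wq /andP[q0 qW]; have W0 := lt_le_trans q0 qW; split=> [k|].
  rewrite /weighted_majority_game big_set1 mxE.
  have /andP[wk0 wkq] := wq k.
  by rewrite [q <= _]leNgt wkq /= divr_ge0 // ltW.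
rewrite game_setT // coalition_payoff_weights.
rewrite (eq_bigl xpredT) ?divff ?gt_eqF // => k; by rewrite finset.in_setT.
Qed.

(** A winning coalition has excess at most [1 - q / W] at the normalized weights,
    hence also at the nucleolus. *)
Lemma nucleolus_winning_payoff x : is_nucleolus v x ->
  imputation v normalized_weights -> 0 < q <= W ->
  forall A, q <= \sum_(k in A) w k -> q / W <= coalition_payoff x A.
Proof.
move=> xnuc wimp /andP[q0 qW] A qA; have W0 := lt_le_trans q0 qW.
have qW1 : q / W <= 1 by rewrite ler_pdivrMr ?mul1r.
have bound B : excess v normalized_weights B <= 1 - q / W.
  rewrite /excess coalition_payoff_weights /weighted_majority_game.
  case: ifP => qB.
    by rewrite lerD2l lerN2 ler_pM2r ?invr_gt0.
  have /andP[wk0 _] : 0 <= (\sum_(k in B) w k) / W <= (\sum_(k in B) w k) / W.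
    rewrite lexx andbT divr_ge0 ?(ltW W0) // sumr_ge0 // => k _.
    have [wi _] := wimp; have := le_trans (game_ge0 _) (wi k).
    by rewrite mxE pmulr_lge0 ?invr_gt0.
  lra.
have := nucleolus_max_excess xnuc wimp bound A.
by rewrite /excess /weighted_majority_game qA lerD2l lerN2.
Qed.

(** [D] bounds the normalized weights; [D < c] makes all singletons lose, which
    ensures that the normalized weights are an imputation to compare with. *)
Lemma nucleolus_near_weights x (c : R) : is_nucleolus v x ->
  0 < q <= W -> (forall k, 0 <= w k <= D * W) ->
  D < c -> c <= q / W -> q / W + D <= 1 - c ->
  forall A, c * `|coalition_payoff x A - (\sum_(k in A) w k) / W| <= D.
Proof.
move=> xnuc qW wD Dc cq qD; have W0 : 0 < W by case/andP: qW; exact: lt_le_trans.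
have wimp : imputation v normalized_weights.
  apply: weights_imputation => // k; have /andP[-> wk] := wD k.
  apply: le_lt_trans wk _; rewrite -ltr_pdivlMr //; exact: lt_le_trans cq.
have := nucleolus_winning_payoff xnuc wimp qW.
move=> win A; rewrite -coalition_payoff_weights.
have n0 : (0 < n)%N.
  case: n w W0 {wD xnuc wimp win A x} => // w'; by rewrite big_ord0 ltxx.
have D0 : 0 <= D.
  have /andP[h1 h2] := wD (Ordinal n0).
  by rewrite -(pmulr_lge0 _ W0); exact: le_trans h2.
have [[xi xN] _] := xnuc.
have sumT (y : 'rV[R]_n) : \sum_k y ord0 k = coalition_payoff y [set: 'I_n]%SET.
  by apply: eq_bigl => k; rewrite finset.in_setT.
have v1 : v [set: 'I_n]%SET = 1 by apply: game_setT; case/andP: qW.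
apply: (payoffs_near_weights (q := q / W)) => //.
- move=> k; rewrite mxE; have /andP[h1 h2] := wD k.
  by rewrite divr_ge0 ?(ltW W0) //= ler_pdivrMr.
- by move=> k; apply: le_trans (xi k); exact: game_ge0.
- by rewrite sumT wimp.2.
- by rewrite sumT xN.
- exact: le_lt_trans Dc.
- move=> S; rewrite -/(coalition_payoff _ S) coalition_payoff_weights.
  by rewrite ler_pM2r ?invr_gt0 //; exact: win.
Qed.

Lemma nucleolus_equal_weights x (a b : 'I_n) : is_nucleolus v x ->
  w a = w b -> x ord0 a = x ord0 b.
Proof.
move=> xnuc wab; rewrite -(nucleolus_symmetric (s := tperm a b) xnuc) ?tpermL //.
move=> A; rewrite /weighted_majority_game big_imset /=; last first.
  by move=> ? ? _ _; exact: perm_inj.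
congr (if q <= _ then _ else _); apply: eq_bigr => k _.
by case: tpermP => // ->.
Qed.

End WeightedMajority.

(** * Passage to the limit *)

Lemma not_cluster_near (R : realType) (u : nat -> R) (p : R) :
  ~ cluster (u @ \oo) p ->
  exists2 e : R, 0 < e & \forall n \near \oo, e <= `|p - u n|.
Proof.
move=> ncl; apply: contrapT => nex; apply: ncl => A B uA /nbhs_ballP[e /= e0 eB].
apply: contrapT => AB; apply: nex; exists e => //.
near=> n; rewrite leNgt; apply/negP => lt; apply: AB; exists (u n); split.
  by near: n; exact: uA.
exact: eB.
Unshelve. all: by end_near. Qed.

Section Limit.
Variables (R : realType) (w q : nat -> R) (x : forall n : nat, 'rV[R]_n).
Hypothesis w_ge0 : forall k : nat, 0 <= w k.
Hypothesis q_bounds : forall n : nat, (0 < n)%N -> 0 < q n <= total_weight w n.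
Hypothesis q_not0 : ~ cluster (normalized_quota q w @ \oo) (0 : R).
Hypothesis q_not1 : ~ cluster (normalized_quota q w @ \oo) (1 : R).
Hypothesis w_to0 : weights_decrease_to0 w.
Hypothesis x_nucleolus : forall n : nat, (0 < n)%N ->
  (exists y : 'rV[R]_n, imputation (sequence_game q w n) y) ->
  is_nucleolus (sequence_game q w n) (x n).

Lemma quota_away_from01 :
  exists2 c : R, 0 < c &
    \forall n \near \oo, c <= normalized_quota q w n <= 1 - c.
Proof.
have [c0 c00 H0] := not_cluster_near q_not0.
have [c1 c10 H1] := not_cluster_near q_not1.
exists (Num.min c0 c1); first by rewrite lt_min c00.
near=> n.
have n0 : (0 < n)%N by near: n; exact: nbhs_infty_gt.
have /andP[qn0 qW] := q_bounds n0; have W0 := lt_le_trans qn0 qW.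
have h0 : c0 <= `|0 - normalized_quota q w n| by near: n.
have h1 : c1 <= `|1 - normalized_quota q w n| by near: n.
have p0 : 0 < normalized_quota q w n by rewrite divr_gt0.
have p1 : normalized_quota q w n <= 1 by rewrite ler_pdivrMr ?mul1r.
rewrite sub0r normrN gtr0_norm // in h0.
rewrite ger0_norm ?subr_ge0 // in h1.
by rewrite ge_min h0 /= lerBrDr addrC -lerBrDr ge_min h1 orbT.
Unshelve. all: by end_near. Qed.

Lemma regular_weight_gt0 j : regular_player w j -> 0 < w j.
Proof.
move=> [e e0 /(_ j.+1 (ltnSn j))].
rewrite lt0r w_ge0 andbT; apply: contraTneq => wj.
by rewrite /normalized_weight wj mul0r mulr0 -ltNge.
Qed.

(** The class [A] of players as heavy as [j] has payoff [m * p] and normalized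
    weight [m * nw >= e], so the deviation of its payoff from its weight is [m * nw]
    times the relative error of [p]. *)
Lemma regular_payoff_asymptotics j : regular_player w j ->
  (fun n => payoff (x n) j / normalized_weight w j n) @ \oo --> (1 : R).
Proof.
move=> jreg; have wj0 := regular_weight_gt0 jreg; have [e e0 je] := jreg.
have [c c0 cq] := quota_away_from01.
apply/cvgrPdist_lt => d d0.
(* Half of [c] absorbs the [D] in [quota + D <= 1 - b]; the second term of [D]
   makes the relative error, which is at most [D / (b * e)], smaller than [d]. *)
pose b := c / 2.
have b0 : 0 < b by rewrite divr_gt0.
pose D := Num.min (b / 2) (b * e * d / 2).
have D0 : 0 < D by rewrite lt_min !(divr_gt0, mulr_gt0).
have Db : D <= b / 2 by rewrite ge_min lexx.
have Dd : D <= b * e * d / 2 by rewrite ge_min lexx orbT.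
have [n0 small] := w_to0.2 D D0.
near=> n.
have jn : (j < n)%N by near: n; exact: nbhs_infty_gt.
have n_gt0 : (0 < n)%N by exact: leq_ltn_trans jn.
have qW := q_bounds n_gt0.
have W0 : 0 < total_weight w n by case/andP: qW; exact: lt_le_trans.
have /andP[cq1 cq2] : c <= normalized_quota q w n <= 1 - c by near: n.
have wD (k : 'I_n) : 0 <= w k <= D * total_weight w n.
  rewrite w_ge0 /= -ler_pdivrMr //; apply: ltW; apply: small => //.
  by near: n; exact: nbhs_infty_ge.
have xnuc : is_nucleolus (sequence_game q w n) (x n).
  apply: x_nucleolus => //; exists (normalized_weights (fun k : 'I_n => w k)).
  apply: weights_imputation => // k; have /andP[-> wk] := wD k.
  apply: le_lt_trans wk _; rewrite -ltr_pdivlMr //.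
  apply: lt_le_trans cq1; rewrite /b in Db; lra.
pose A := [set k : 'I_n | w k == w j]%SET.
pose m : R := (multiplicity w (w j) n)%:R.
set nw := normalized_weight w j n.
have nw0 : 0 < nw by rewrite divr_gt0.
pose j' := Ordinal jn.
have payj : payoff (x n) j = x n ord0 j'.
  by rewrite /payoff (insubT (fun k => (k < n)%N) jn).
have xA : coalition_payoff (x n) A = m * payoff (x n) j.
  rewrite /coalition_payoff (eq_bigr (fun=> payoff (x n) j)).
    by rewrite big_const iter_addr addr0 mulr_natl.
  move=> k; rewrite inE payj => /eqP wk.
  exact: (nucleolus_equal_weights xnuc).
have wA : (\sum_(k in A) w k) / total_weight w n = m * nw.
  rewrite (eq_bigr (fun=> w j)); last by move=> k; rewrite inE => /eqP.
  by rewrite big_const iter_addr addr0 /nw /normalized_weight mulrA mulr_natl.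
have := @nucleolus_near_weights R n (q n) D (fun k : 'I_n => w k) (x n) b xnuc qW wD.
rewrite -/(normalized_quota q w n) => near_w.
have {near_w} : b * `|coalition_payoff (x n) A - (\sum_(k in A) w k) / total_weight w n| <= D.
  apply: near_w; rewrite -?/(normalized_quota q w n); rewrite /b in Db b0 *; lra.
rewrite xA wA -mulrBr normrM ger0_norm; last by rewrite /m ler0n.
set p := payoff (x n) j => hp.
have em : e <= m * nw by exact: je.
have -> : 1 - p / nw = (nw - p) / nw by field; rewrite gt_eqF.
rewrite normrM normfV (gtr0_norm nw0) distrC.
set r := `|p - nw| / nw.
have r0 : 0 <= r by rewrite divr_ge0 // ltW.
have pr : `|p - nw| = nw * r by rewrite /r; field; rewrite gt_eqF.
rewrite pr in hp.
have h1 : b * e * r <= D.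
  apply: le_trans hp; rewrite -mulrA ler_pM2l // [m * _]mulrA.
  by rewrite ler_wpM2r.
have : b * e * r < b * e * d.
  apply: le_lt_trans h1 _; apply: le_lt_trans Dd _.
  have := mulr_gt0 (mulr_gt0 b0 e0) d0; lra.
by rewrite ltr_pM2l // mulr_gt0.
Unshelve. all: by end_near. Qed.

End Limit.

Theorem proposition1 (R : realType) (w q : nat -> R)
  (w_ge0 : forall k : nat, 0 <= w k)
  (q_bounds : forall n : nat, (0 < n)%N -> 0 < q n <= total_weight w n)
  (q_not0 : ~ cluster (normalized_quota q w @ \oo) (0 : R))
  (q_not1 : ~ cluster (normalized_quota q w @ \oo) (1 : R))
  (w_to0 : weights_decrease_to0 w)
  (x : forall n : nat, 'rV[R]_n)
  (x_nucleolus : forall n : nat, (0 < n)%N ->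
     (exists y : 'rV[R]_n, imputation (sequence_game q w n) y) ->
     is_nucleolus (sequence_game q w n) (x n))
  (i j : nat) (i_regular : regular_player w i) (j_regular : regular_player w j) :
  (fun n : nat => payoff (x n) i / payoff (x n) j) @ \oo --> w i / w j.
Proof.
have lim := regular_payoff_asymptotics w_ge0 q_bounds q_not0 q_not1 w_to0 x_nucleolus.
have wi := regular_weight_gt0 w_ge0 i_regular.
have wj := regular_weight_gt0 w_ge0 j_regular.
pose r k n := payoff (x n) k / normalized_weight w k n.
have : (fun n => r i n * (r j n)^-1 * (w i / w j)) @ \oo --> 1 * 1^-1 * (w i / w j).
  apply: cvgMl; apply: cvgM; first exact: lim.
  by apply: cvgV; [rewrite oner_neq0 | exact: lim].
rewrite invr1 !mul1r; apply: cvg_trans; apply: near_eq_cvg.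
near=> n.
have n0 : (0 < n)%N by near: n; exact: nbhs_infty_gt.
have W0 : 0 < total_weight w n by case/andP: (q_bounds n n0); exact: lt_le_trans.
rewrite /r /normalized_weight [(payoff (x n) j / _)^-1]invfM invrK.
set p := (payoff (x n) j)^-1.
by field; rewrite !gt_eqF.
Unshelve. all: by end_near. Qed.
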